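(* For any group $G$, there exists a category with concentration $(\mathcal{C},\sim)$ such that $\mathcal{C}$ is equivalent to the trivial category, and the concentration monoid $M_{(\mathcal{C},\sim)}$ is isomorphic to $G$.
   Context: The trivial category has one object and only its identity morphism. For a small category $\mathcal{C}$, $\mathrm{Mor}_{\mathcal{C}}$ is the set of all its morphisms; $f\circ g$ means first $g$, then $f$. A concentration structure on $\mathcal{C}$ is an equivalence relation $\sim$ on $\mathrm{Mor}_{\mathcal{C}}$ such that: (1) $\mathrm{id}_A\sim \mathrm{id}_B$ for all objects $A,B$; (2) if $f\sim f'$, $g\sim g'$ and both $f\circ g$, $f'\circ g'$ exist, then $f\circ g\sim f'\circ g'$; (3) for any morphisms $f,g$ there exist $f'\sim f$ and $g'\sim g$ such that $f'\circ g'$ exists; (4) for any morphisms $f\sim f'$, $g\sim g'$, $h\sim h'$, $m\sim f\circ g$, $n\sim g'\circ h'$, one has $f'\circ n\sim m\circ h$ whenever all the compositions involved are defined. The pair $(\mathcal{C},\sim)$ is called a category with concentration. The concentration monoid of $(\mathcal{C},\sim)$ is $M_{(\mathcal{C},\sim)}=\mathrm{Mor}_{\mathcal{C}}/\sim$ with multiplication $[f][g]=[f'\circ g']$, where $f'\sim f$, $g'\sim g$ are any morphisms such that $f'\circ g'$ exists; its identity is the class of any identity morphism. *)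

(* Defs.v *)
From HB Require Import structures.
From mathcomp Require Import all_boot.
From mathcomp Require Import boolp.
From Stdlib Require Import RelationClasses.

Set Implicit Arguments.
Unset Strict Implicit.
Unset Printing Implicit Defensive.

Local Open Scope quotient_scope.

Reserved Notation "f \oc g" (at level 40, left associativity).

Record category := Category {
  obj :> Type;
  hom : obj -> obj -> Type;
  idm : forall A : obj, hom A A;
  comp : forall A B C : obj, hom B C -> hom A B -> hom A C;
  comp_idl : forall (A B : obj) (f : hom A B), comp (idm B) f = f;
  comp_idr : forall (A B : obj) (f : hom A B), comp f (idm A) = f;
  compA : forall (A B C D : obj) (f : hom C D) (g : hom B C) (h : hom A B),
    comp f (comp g h) = comp (comp f g) h
}.

Arguments idm {c} A.
Arguments comp {c A B C} f g.

(* [f \oc g] is first [g], then [f]. *)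
Notation "f \oc g" := (comp f g).

Record functor (C D : category) := Functor {
  fobj :> C -> D;
  fmap : forall A B : C, hom A B -> hom (fobj A) (fobj B);
  fmap_id : forall A : C, fmap (idm A) = idm (fobj A);
  fmap_comp : forall (X Y Z : C) (f : hom Y Z) (g : hom X Y),
    fmap (f \oc g) = fmap f \oc fmap g
}.

Definition functor_id (C : category) : functor C C :=
  @Functor C C (fun A => A) (fun _ _ f => f) (fun _ => erefl)
    (fun _ _ _ _ _ => erefl).

Section FunctorComp.
Variables (C D E : category) (F : functor D E) (G : functor C D).

Let cobj (A : C) : E := F (G A).
Let cmap (A B : C) (f : hom A B) : hom (cobj A) (cobj B) := fmap F (fmap G f).

Fact functor_comp_id (A : C) : cmap (idm A) = idm (cobj A).
Proof. by rewrite /cmap !fmap_id. Qed.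

Fact functor_comp_comp (X Y Z : C) (f : hom Y Z) (g : hom X Y) :
  cmap (f \oc g) = cmap f \oc cmap g.
Proof. by rewrite /cmap !fmap_comp. Qed.

Definition functor_comp : functor C E :=
  Functor functor_comp_id functor_comp_comp.
End FunctorComp.

Definition is_iso (C : category) (A B : C) (f : hom A B) : Prop :=
  exists g : hom B A, g \oc f = idm A /\ f \oc g = idm B.

Definition naturally_isomorphic (C D : category) (F G : functor C D) : Prop :=
  exists t : forall A : C, hom (F A) (G A),
    (forall (A B : C) (f : hom A B), fmap G f \oc t A = t B \oc fmap F f) /\
    (forall A : C, is_iso (t A)).

Definition equivalent (C D : category) : Prop :=
  exists (F : functor C D) (G : functor D C),
    naturally_isomorphic (functor_comp G F) (functor_id C) /\
    naturally_isomorphic (functor_comp F G) (functor_id D).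

Definition trivial_category : category :=
  @Category unit (fun _ _ => unit) (fun _ => tt) (fun _ _ _ _ _ => tt)
    (fun _ _ f => let: tt := f in erefl) (fun _ _ f => let: tt := f in erefl)
    (fun _ _ _ _ _ _ _ => erefl).

(* Packing an arrow with its ends lets arrows of different types be compared:
   the composite of two elements of [mor C] exists when they have the form
   [Mor f] and [Mor g] with [f : hom B X] and [g : hom A B]. *)
Record mor (C : category) := Mor { src : C; tgt : C; arr : hom src tgt }.

Arguments Mor {C src tgt} arr.

HB.instance Definition _ (C : category) := gen_eqMixin (mor C).
HB.instance Definition _ (C : category) := gen_choiceMixin (mor C).

Record concentration (C : category) := Concentration {
  conc :> mor C -> mor C -> Prop;
  conc_equiv : Equivalence conc;
  conc_id : forall A B : C, conc (Mor (idm A)) (Mor (idm B));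
  conc_comp : forall (X Y Z X' Y' Z' : C)
      (f : hom Y Z) (g : hom X Y) (f' : hom Y' Z') (g' : hom X' Y'),
    conc (Mor f) (Mor f') -> conc (Mor g) (Mor g') ->
    conc (Mor (f \oc g)) (Mor (f' \oc g'));
  conc_ex : forall f g : mor C,
    exists (X Y Z : C) (f' : hom Y Z) (g' : hom X Y),
      conc (Mor f') f /\ conc (Mor g') g;
  (* The four composites impose only: cod g = dom f, cod h' = dom g',
     cod n = dom f' and cod h = dom m. *)
  conc_assoc : forall (A1 A2 A3 B1 B2 B3 P Q R S T U : C)
      (f : hom A2 A3) (g : hom A1 A2) (g' : hom B2 B3) (h' : hom B1 B2)
      (f' : hom Q R) (n : hom P Q) (m : hom T U) (h : hom S T),
    conc (Mor f) (Mor f') -> conc (Mor g) (Mor g') -> conc (Mor h) (Mor h') ->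
    conc (Mor m) (Mor (f \oc g)) -> conc (Mor n) (Mor (g' \oc h')) ->
    conc (Mor (f' \oc n)) (Mor (m \oc h))
}.

(* The empty category satisfies the four axioms vacuously, but its set of
   classes is empty and has no identity; hence the last field. *)
Record conc_category := ConcCategory {
  cc_cat :> category;
  cc_conc : concentration cc_cat;
  cc_inh : inhabited cc_cat
}.

Section ConcMonoid.
Variable K : conc_category.
Local Notation "f ~~~ g" := (cc_conc K f g) (at level 70).

Let sim_refl f : f ~~~ f.
Proof. by case: (conc_equiv (cc_conc K)) => r _ _; exact: r. Qed.

Let sim_sym f g : f ~~~ g -> g ~~~ f.
Proof. by case: (conc_equiv (cc_conc K)) => _ s _; exact: s. Qed.

Let sim_trans g f h : f ~~~ g -> g ~~~ h -> f ~~~ h.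
Proof. by case: (conc_equiv (cc_conc K)) => _ _ t; exact: t. Qed.

Definition conc_rel : rel (mor K) := fun f g => `[< f ~~~ g >].

Fact conc_rel_refl : reflexive conc_rel.
Proof. by move=> f; apply/asboolP. Qed.

Fact conc_rel_sym : symmetric conc_rel.
Proof. by move=> f g; apply/asboolP/asboolP; exact: sim_sym. Qed.

Fact conc_rel_trans : transitive conc_rel.
Proof.
by move=> g f h /asboolP fg /asboolP gh; apply/asboolP; exact: sim_trans gh.
Qed.

Canonical conc_equiv_rel :=
  EquivRel conc_rel conc_rel_refl conc_rel_sym conc_rel_trans.

Definition conc_monoid := {eq_quot conc_equiv_rel}.

HB.instance Definition _ := Choice.on conc_monoid.

Definition conc_class (f : mor K) : conc_monoid := \pi_{eq_quot conc_equiv_rel} f.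

Lemma conc_classP (f g : mor K) : conc_class f = conc_class g <-> f ~~~ g.
Proof.
split=> [/eqP|fg]; first by rewrite /conc_class eqmodE => /asboolP.
by apply/eqP; rewrite /conc_class eqmodE; apply/asboolP.
Qed.

Lemma conc_classW (x : conc_monoid) : exists f, x = conc_class f.
Proof. by exists (repr x); rewrite /conc_class reprK. Qed.

Fact conc_mul_subproof (x y : conc_monoid) :
  exists z : conc_monoid, exists (X Y Z : K) (f : hom Y Z) (g : hom X Y),
    [/\ conc_class (Mor f) = x, conc_class (Mor g) = y
      & z = conc_class (Mor (f \oc g))].
Proof.
have [f ->] := conc_classW x; have [g ->] := conc_classW y.
have [X [Y [Z [f' [g' [ff' gg']]]]]] := conc_ex (cc_conc K) f g.
exists (conc_class (Mor (f' \oc g'))), X, Y, Z, f', g'.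
by split=> //; apply/conc_classP.
Qed.

(* The value does not depend on the choice: see [conc_mulE]. *)
Definition conc_mul (x y : conc_monoid) : conc_monoid :=
  projT1 (cid (conc_mul_subproof x y)).

Lemma conc_mulE (X Y Z : K) (f : hom Y Z) (g : hom X Y) :
  conc_mul (conc_class (Mor f)) (conc_class (Mor g)) =
  conc_class (Mor (f \oc g)).
Proof.
rewrite /conc_mul; case: cid => z /= [X' [Y' [Z' [f' [g' [ff' gg' ->]]]]]].
by apply/conc_classP; apply: conc_comp; apply/conc_classP.
Qed.

Definition conc_one : conc_monoid :=
  conc_class (Mor (idm (projT1 (cid (let: inhabits A := cc_inh K in
    ex_intro (fun _ : K => True) A I))))).

Lemma conc_oneE (A : K) : conc_one = conc_class (Mor (idm A)).
Proof. by apply/conc_classP; apply: conc_id. Qed.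

Let conc_mulP (x y : conc_monoid) :
  exists (X Y Z : K) (f : hom Y Z) (g : hom X Y),
    [/\ x = conc_class (Mor f), y = conc_class (Mor g)
      & conc_mul x y = conc_class (Mor (f \oc g))].
Proof.
have [z [X [Y [Z [f [g [<- <- _]]]]]]] := conc_mul_subproof x y.
by exists X, Y, Z, f, g; rewrite conc_mulE.
Qed.

Fact conc_mulA : associative conc_mul.
Proof.
move=> x y z.
have [A1 [A2 [A3 [f [g [xf yg xy]]]]]] := conc_mulP x y.
have [B1 [B2 [B3 [g' [h' [yg' zh' yz]]]]]] := conc_mulP y z.
have [P [Q [R [f' [n [xf' yzn ->]]]]]] := conc_mulP x (conc_mul y z).
have [S [T [U [m [h [xym zh ->]]]]]] := conc_mulP (conc_mul x y) z.
apply/conc_classP.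
by apply: (conc_assoc (f := f) (g := g) (g' := g') (h' := h'));
  apply/conc_classP; congruence.
Qed.

Fact conc_mul1 : left_id conc_one conc_mul.
Proof.
move=> x; have [[A B f] ->] := conc_classW x.
by rewrite (conc_oneE B) conc_mulE comp_idl.
Qed.

Fact conc_mulr1 : right_id conc_one conc_mul.
Proof.
move=> x; have [[A B f] ->] := conc_classW x.
by rewrite (conc_oneE A) conc_mulE comp_idr.
Qed.

HB.instance Definition _ :=
  isMonoid.Build conc_monoid conc_mulA conc_mul1 conc_mulr1.
End ConcMonoid.

(* Main.v *)
Require Import Defs.
From HB Require Import structures.
From mathcomp Require Import all_boot.

(** A concentration may be obtained by reading arrows in a monoid.  Suppose a
    functor [w] from a category [C] to a monoid [M] (a category with a single
    object) is such that any two elements of [M] label two composable arrows.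
    Having the same label is then a concentration: axioms (1) and (2) hold by
    functoriality, (3) is the assumption on [w], and (4) is associativity in
    [M].  Multiplication of classes is multiplication of labels, so the
    concentration monoid is [M] itself ([label_of_class_bij]).

    It remains to find such a labelling by [G] on a category equivalent to the
    trivial one.  The indiscrete category on the set [G], with exactly one
    arrow between any two objects, is equivalent to the trivial category since
    all its objects are isomorphic and it has no nontrivial endomorphism.
    Label the arrow from [a] to [b] by [b * a^-1].  Labels telescope along
    composites, and given [x] and [y] the path [1 -> y -> x * y] consists of an
    arrow labelled [y] followed by an arrow labelled [x]. *)

Set Implicit Arguments.
Unset Strict Implicit.
Unset Printing Implicit Defensive.

Local Open Scope group_scope.
Local Open Scope quotient_scope.

(** * Concentrations given by labels in a monoid *)

(** A functor from [C] to the one-object category of [M].  The last field asks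
    for composable arrows, so that any two classes can be multiplied; it also
    makes the labels exhaust [M]. *)
Record labelling (C : category) (M : monoidType) := Labelling {
  label : forall A B : C, hom A B -> M;
  label_id : forall A : C, label (idm A) = 1;
  label_comp : forall (X Y Z : C) (f : hom Y Z) (g : hom X Y),
    label (f \oc g) = label f * label g;
  label_pair : forall x y : M,
    exists (X Y Z : C) (f : hom Y Z) (g : hom X Y), label f = x /\ label g = y
}.

Arguments label {C M} l {A B} f.

Section LabelConcentration.
Variables (C : category) (M : monoidType) (w : labelling C M).

Definition mor_label (f : mor C) : M := label w (arr f).

Definition same_label (f g : mor C) : Prop := mor_label f = mor_label g.

Lemma same_label_equiv : RelationClasses.Equivalence same_label.
Proof. by split=> [f | f g | f g h]; rewrite /same_label // => ->. Qed.

Lemma same_label_id (A B : C) : same_label (Mor (idm A)) (Mor (idm B)).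
Proof. by rewrite /same_label /mor_label /= !label_id. Qed.

Lemma same_label_comp (X Y Z X' Y' Z' : C)
    (f : hom Y Z) (g : hom X Y) (f' : hom Y' Z') (g' : hom X' Y') :
  same_label (Mor f) (Mor f') -> same_label (Mor g) (Mor g') ->
  same_label (Mor (f \oc g)) (Mor (f' \oc g')).
Proof.
by rewrite /same_label /mor_label /= !label_comp => -> ->.
Qed.

Lemma same_label_ex (f g : mor C) :
  exists (X Y Z : C) (f' : hom Y Z) (g' : hom X Y),
    same_label (Mor f') f /\ same_label (Mor g') g.
Proof. exact: label_pair. Qed.

Lemma same_label_assoc (A1 A2 A3 B1 B2 B3 P Q R S T U : C)
    (f : hom A2 A3) (g : hom A1 A2) (g' : hom B2 B3) (h' : hom B1 B2)
    (f' : hom Q R) (n : hom P Q) (m : hom T U) (h : hom S T) :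
  same_label (Mor f) (Mor f') -> same_label (Mor g) (Mor g') ->
  same_label (Mor h) (Mor h') -> same_label (Mor m) (Mor (f \oc g)) ->
  same_label (Mor n) (Mor (g' \oc h')) ->
  same_label (Mor (f' \oc n)) (Mor (m \oc h)).
Proof.
rewrite /same_label /mor_label /= !label_comp => -> -> -> -> ->.
exact: mulgA.
Qed.

Definition label_concentration : concentration C :=
  Concentration same_label_equiv same_label_id same_label_comp same_label_ex
    same_label_assoc.

Lemma labelled_inhabited : inhabited C.
Proof. by have [X _] := label_pair w 1 1. Qed.

Definition label_conc_category : conc_category :=
  ConcCategory label_concentration labelled_inhabited.

Local Notation K := label_conc_category.

Definition label_of_class (c : conc_monoid K) : M := mor_label (repr c).

Lemma label_of_classE (f : mor C) :
  label_of_class (@conc_class K f) = mor_label f.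
Proof. by apply/(@conc_classP K); exact: reprK. Qed.

Lemma label_of_class1 : label_of_class 1 = 1.
Proof.
have [A] := labelled_inhabited.
rewrite [1](conc_oneE (K := K) A) label_of_classE.
exact: label_id.
Qed.

Lemma label_of_classM : {morph label_of_class : x y / x * y}.
Proof.
move=> x y.
(* The product of two classes is only computable on composable arrows. *)
have [_ [X [Y [Z [f [g [<- <- _]]]]]]] := conc_mul_subproof x y.
rewrite [_ * _ in LHS](conc_mulE (K := K)) !label_of_classE.
exact: label_comp.
Qed.

HB.instance Definition _ :=
  isMultiplicative.Build (conc_monoid K) M label_of_class label_of_classM.
HB.instance Definition _ :=
  Multiplicative_isUMagmaMorphism.Build (conc_monoid K) M
    label_of_class label_of_class1.

(** Injective because classes are the fibres of the labels; surjective because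
    every element of [M] occurs in a realised pair. *)
Lemma label_of_class_bij : bijective label_of_class.
Proof.
have arrow_of x : exists f : mor C, mor_label f == x.
  have [X [Y [Z [f [_ [fx _]]]]]] := label_pair w x x.
  by exists (Mor f); apply/eqP.
exists (fun x => @conc_class K (xchoose (arrow_of x))).
- move=> c; have [f ->] := conc_classW c.
  apply/(@conc_classP K).
  by rewrite /= /same_label (eqP (xchooseP (arrow_of _))) label_of_classE.
- by move=> x; rewrite label_of_classE (eqP (xchooseP (arrow_of x))).
Qed.

End LabelConcentration.

(** * Indiscrete categories *)

Definition indiscrete (T : Type) : category :=
  @Category T (fun _ _ => unit) (fun _ => tt) (fun _ _ _ _ _ => tt)
    (fun _ _ f => let: tt := f in erefl) (fun _ _ f => let: tt := f in erefl)
    (fun _ _ _ _ _ _ _ => erefl).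

(** All hom-sets being singletons, any choice of an object is inverse, up to
    isomorphism, to the functor to the trivial category. *)
Lemma indiscrete_equivalent (T : Type) (t : T) :
  equivalent (indiscrete T) trivial_category.
Proof.
exists (@Functor (indiscrete T) trivial_category (fun _ => tt) (fun _ _ _ => tt)
  (fun _ => erefl) (fun _ _ _ _ _ => erefl)).
exists (@Functor trivial_category (indiscrete T) (fun _ => t) (fun _ _ _ => tt)
  (fun _ => erefl) (fun _ _ _ _ _ => erefl)).
split.
- by exists (fun _ => tt); split=> // A; exists tt.
- by exists (fun A : unit => tt); split=> // A; exists tt.
Qed.

Section QuotientLabelling.
Variable G : groupType.

Definition quotient_label (a b : indiscrete G) (_ : hom a b) : G :=
  (b : G) / (a : G).

Lemma quotient_label_id (a : indiscrete G) : quotient_label (idm a) = 1.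
Proof. exact: mulgV. Qed.

Lemma quotient_label_comp (a b c : indiscrete G) (f : hom b c) (g : hom a b) :
  quotient_label (f \oc g) = quotient_label f * quotient_label g.
Proof. by rewrite /quotient_label mulgA mulgVK. Qed.

Lemma quotient_label_pair (x y : G) :
  exists (a b c : indiscrete G) (f : hom b c) (g : hom a b),
    quotient_label f = x /\ quotient_label g = y.
Proof.
exists (1 : G), y, (x * y), tt, tt.
by rewrite /quotient_label mulgK invg1 mulg1.
Qed.

Definition quotient_labelling : labelling (indiscrete G) G :=
  Labelling quotient_label_id quotient_label_comp quotient_label_pair.

End QuotientLabelling.

Theorem theorem1p15 (G : groupType) :
  exists K : conc_category,
    equivalent K trivial_category /\
    exists phi : UMagmaMorphism.type (conc_monoid K) G, bijective phi.
Proof.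
exists (label_conc_category (quotient_labelling G)); split.
  exact: indiscrete_equivalent (1 : G).
by exists (label_of_class (w := quotient_labelling G));
  exact: label_of_class_bij.
Qed.
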